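(* Let $x,y\in X$ be distinct. (1) If $1\leq\partial(x,y)<k$, then $\widehat{x},\ \widehat{y},\ \widehat{x\cap y},\ \widehat{x+y}$ form a basis for $\mathrm{Fix}(x,y)$. (2) If $\partial(x,y)=k$, then $\widehat{x},\ \widehat{y},\ \widehat{x+y}$ form a basis for $\mathrm{Fix}(x,y)$. (These bases are called the geometric basis for $\mathrm{Fix}(x,y)$.)
   Context: Let $\mathbb{F}_q$ be a finite field with $q$ elements, let $n,k$ be integers with $n>2k\geq 6$, and let $V$ be an $n$-dimensional vector space over $\mathbb{F}_q$. For $m\in\mathbb{Z}$ write $[m]=(q^m-1)/(q-1)$. Let $P$ be the set of all subspaces of $V$ and $P_\ell$ the set of $\ell$-dimensional subspaces; put $X=P_k$. The Grassmann graph $\Gamma=J_q(n,k)$ has vertex set $X$, with $x,y\in X$ adjacent iff $\dim(x\cap y)=k-1$; $\partial$ is its path-length distance. Let $E$ be a (real) Euclidean space of dimension $[n]-1$ with inner product $\langle\,,\,\rangle$, and let $P_1\to E$, $s\mapsto\widehat{s}$ be a map such that: $E=\mathrm{Span}\{\widehat{s}\mid s\in P_1\}$; $\|\widehat{s}\|^2=[n]-1$ for $s\in P_1$; $\langle\widehat{s},\widehat{t}\rangle=-1$ for distinct $s,t\in P_1$; and $\sum_{s\in P_1}\widehat{s}=0$. For $u\in P$ define $\widehat{u}=\sum_{s\in P_1,\,s\subseteq u}\widehat{s}$. The group $GL(V)$ acts on $P$, and acts linearly on $E$ by the (unique) action satisfying $\sigma(\widehat{u})=\widehat{\sigma(u)}$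 for all $u\in P$, $\sigma\in GL(V)$. For $u,v\in P$, $\mathrm{Stab}(u,v)$ is the subgroup of $GL(V)$ of elements $\sigma$ with $\sigma(u)=u$ and $\sigma(v)=v$, and $\mathrm{Fix}(u,v)$ is the subspace of $E$ of vectors fixed by every element of $\mathrm{Stab}(u,v)$. *)

(* Defs.v *)
From HB Require Import structures.
From mathcomp Require Import all_boot all_order all_algebra.
From mathcomp Require Import reals.

Set Implicit Arguments.
Unset Strict Implicit.
Unset Printing Implicit Defensive.

Import Order.TTheory GRing.Theory Num.Theory.
Local Open Scope ring_scope.

(* Over a finite field, vector spaces have finitely many subspaces and finitely
   many endomorphisms; these instances allow \sum and \bigcap over them. *)
Import VectorInternalTheory.
HB.instance Definition _ (F : finFieldType) (V : vectType F) :=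
  [Countable of {vspace V} by <:].
HB.instance Definition _ (F : finFieldType) (V : vectType F) :=
  [Finite of {vspace V} by <:].
HB.instance Definition _ (F : finFieldType) (V W : vectType F) :=
  [Countable of 'Hom(V, W) by <:].
HB.instance Definition _ (F : finFieldType) (V W : vectType F) :=
  [Finite of 'Hom(V, W) by <:].

Notation subsp V l := {u : {vspace V} | \dim u == l%N}.

(* [m] = (q^m - 1)/(q - 1), as a real number, for m an integer *)
Definition qbracket (R : realType) (q : nat) (m : int) : R :=
  ((q%:R : R) ^ m - 1) / (q%:R - 1).

(* Path-length distance of the graph e: the least length of an e-path from x to
   y.  Only lengths below #|T| need be tried, since a shortest path has no
   repeated vertex; the value is #|T| when y is unreachable from x. *)
Definition gdist (T : finType) (e : rel T) (x y : T) : nat :=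
  find (fun l => [exists p : l.-tuple T, path e x p && (last x p == y)])
       (iota 0 #|T|).

Lemma gdist_le (T : finType) (e : rel T) (x : T) (p : seq T) :
  path e x p -> (gdist e x (last x p) <= size p)%N.
Proof.
move=> ep; rewrite leqNgt; apply/negP => lt.
have szT : (size p < #|T|)%N.
  by apply: leq_trans lt _; rewrite -[leqRHS](size_iota 0) find_size.
have := before_find 0%N lt; rewrite nth_iota // add0n => /negbT/negP; apply.
by apply/existsP; exists (in_tuple p); rewrite ep /=.
Qed.

Lemma gdist_path (T : finType) (e : rel T) (x y : T) :
  connect e x y ->
  exists p, [/\ path e x p, last x p = y & size p = gdist e x y].
Proof.
case/connectP => p0 /shortenP[p ep up _] ->.
set P := fun l => [exists q : l.-tuple T, path e x q && (last x q == last x p)].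
have szT : (size p < #|T|)%N.
  by have /card_uniqP := up => /= <-; apply: max_card.
have hP : has P (iota 0 #|T|).
  apply/hasP; exists (size p); first by rewrite mem_iota.
  by apply/existsP; exists (in_tuple p); rewrite ep /=.
have := nth_find 0%N hP; rewrite nth_iota; last first.
  by rewrite -[ltnRHS](size_iota 0) -has_find.
rewrite add0n => /existsP[q /andP[eq /eqP lq]].
by exists q; split => //; rewrite size_tuple.
Qed.

(* Grassmann graph J_q(n, k), with n = \dim V; it is only used for k > 0. *)
Definition grassmann (F : finFieldType) (V : vectType F) (k : nat) :
    rel (subsp V k) :=
  fun x y => \dim (val x :&: val y)%VS == k.-1.

Definition hat (R : realType) (F : finFieldType) (V : vectType F)
    (E : vectType R) (h : subsp V 1 -> E) (u : {vspace V}) : E :=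
  \sum_(s : subsp V 1 | (val s <= u)%VS) h s.

Definition GL (F : finFieldType) (V : vectType F) : {set 'End(V)} :=
  [set g | lker g == 0%VS].

(* act is the linear action of GL(V) on E with act g (hat u) = hat (g u);
   its values outside GL(V) are irrelevant. *)
Definition GL_action (R : realType) (F : finFieldType) (V : vectType F)
    (E : vectType R) (h : subsp V 1 -> E) (act : 'End(V) -> 'End(E)) : Prop :=
  [/\ act \1%VF = \1%VF,
      {in GL V &, forall f g, act (f \o g)%VF = (act f \o act g)%VF}
    & {in GL V, forall g (u : {vspace V}), act g (hat h u) = hat h (g @: u)%VS}].

Definition Stab (F : finFieldType) (V : vectType F) (u v : {vspace V}) :
    {set 'End(V)} :=
  [set g in GL V | (g @: u == u)%VS && (g @: v == v)%VS].

Definition Fix (R : realType) (F : finFieldType) (V : vectType F)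
    (E : vectType R) (act : 'End(V) -> 'End(E)) (u v : {vspace V}) :
    {vspace E} :=
  (\bigcap_(g in Stab u v) fixedSpace (act g))%VS.

(* Main.v *)
Require Import Defs.
From HB Require Import structures.
From mathcomp Require Import all_boot all_order all_algebra.
From mathcomp Require Import reals ring zify.

Set Implicit Arguments.
Unset Strict Implicit.
Unset Printing Implicit Defensive.

Import Order.TTheory GRing.Theory Num.Theory.
Local Open Scope ring_scope.

(** The point vectors form a regular simplex: their Gram matrix is N I - J with
    N = [n], and they sum to zero. Hence the only linear relations between them
    are the multiples of that sum (simplex_relation), and every vector v
    satisfies v = N^-1 \sum_t <v, t^> t^ (simplex_expand). As GL(V) permutes the
    point vectors, it preserves the inner product, so v lies in Fix(x,y) exactly
    when its coordinate function t |-> <v, t^> is constant on the orbits of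
    Stab(x,y) on points.

    Those orbits are read off from the classes cut out by x, y and x + y: the
    points of x :&: y, those of x only, those of y only, those of x + y outside
    both x and y, and those outside x + y (invariant_classes). Transitivity on a
    class comes from shears v |-> v + phi(v) w, where phi is a linear functional:
    a shear fixes ker phi pointwise and stabilises every subspace containing w,
    so it lies in Stab(x,y) once each of x and y is inside ker phi or contains w.
    One shear suffices on each class except the fourth, where the components in
    x and in y are moved one after the other.

    A function constant on the five classes is a combination of the constant 1
    and the indicators of x, y, x :&: y and x + y; these go to 0, x^, y^,
    (x :&: y)^ and (x + y)^, which therefore span Fix(x,y). Conversely a linear
    relation between the four vectors says that the corresponding combination
    of indicators is constant on points. Since dim (x + y) <= 2k < n, the
    constant is 0, and evaluation on one point of each class kills the
    coefficients one by one, that of x :&: y only when x :&: y has a point. The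
    two cases of the theorem are separated by the distance formula
    d(x,y) + dim (x :&: y) = k (gdist_grassmann). *)

(** * Shears *)

(** A coordinate of the projection along U, chosen to be nonzero at u. *)
Lemma functional_neq0 (K : fieldType) (V : vectType K) (U : {vspace V}) (u : V) :
  u \notin U ->
  exists phi : {scalar V}, {in U, forall v, phi v = 0} /\ phi u != 0.
Proof.
move=> uNU; set p := (\1 - projv U)%VF.
have pE v : p v = v - projv U v by rewrite !lfun_simp.
have pU v : v \in U -> p v = 0 by move=> vU; rewrite pE projv_id ?subrr.
have pu0 : p u != 0.
  by apply: contraNneq uNU => /eqP; rewrite pE subr_eq0 => /eqP->; apply: memv_proj.
case: (pickP (fun i => coord (vbasis {:V}) i (p u) != 0)) => [i ci|c0].
  exists (coord (vbasis {:V}) i \o p : {scalar V}) => /=; split => // v vU.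
  by rewrite pU ?linear0.
case/eqP: pu0; rewrite (coord_vbasis (memvf (p u))) big1 // => i _.
by have /negbFE/eqP-> := c0 i; rewrite scale0r.
Qed.

(** If neither the functional for u nor the one for u' is nonzero at both
    vectors, then each vanishes at the other vector, and their sum works. *)
Lemma functional_neq0_pair (K : fieldType) (V : vectType K) (U : {vspace V})
    (u u' : V) : u \notin U -> u' \notin U ->
  exists phi : {scalar V},
    [/\ {in U, forall v, phi v = 0}, phi u != 0 & phi u' != 0].
Proof.
move=> /functional_neq0[f [fU fu]] /functional_neq0[g [gU gu']].
have [fu'|] := eqVneq (f u') 0; last by exists f.
have [gu|] := eqVneq (g u) 0; last by exists g.
exists (f \+ g : {scalar V}) => /=; split=> [v vU||].
- by rewrite fU // gU // addr0.
- by rewrite gu addr0.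
- by rewrite fu' add0r.
Qed.

(** The shear is v |-> v + (phi v / phi u) (u' - u) with phi vanishing on U.
    It is injective because phi (g v) = phi v * phi u' / phi u, which is why
    phi u' != 0 is needed besides phi u != 0. *)
Lemma shear_exists (K : fieldType) (V : vectType K) (U : {vspace V}) (u u' : V) :
  u \notin U -> u' \notin U ->
  exists g : 'End(V),
    [/\ lker g == 0%VS, g u = u', {in U, forall v, g v = v}
      & forall v, g v - v \in <[u' - u]>%VS].
Proof.
move=> uU u'U; have [phi [phiU phiu phiu']] := functional_neq0_pair uU u'U.
pose f v := v + ((phi u)^-1 * phi v) *: (u' - u).
have f_lin : linear f.
  move=> a v w; rewrite /f linearP /= mulrDr scalerDl [in RHS]scalerDr.
  by rewrite scalerA mulrCA addrACA.
pose fL := GRing.isLinear.Build K V V *:%R f f_lin.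
pose F : {linear V -> V} := HB.pack f fL.
have gE v : linfun F v = f v by rewrite lfunE.
exists (linfun F); split.
- apply/lker0P/raddf_inj => v; rewrite /= gE /f => /eqP; rewrite addr_eq0 => /eqP vE.
  have /eqP : phi v = - (((phi u)^-1 * phi v) * (phi u' - phi u)).
    by rewrite {1}vE linearN linearZ linearB.
  rewrite mulrBr [_ * phi u]mulrAC mulVf // mul1r opprB -subr_eq0 opprB addrC subrK.
  rewrite !mulf_eq0 invr_eq0 (negPf phiu) (negPf phiu') /= orbF.
  by move=> /eqP phiv; rewrite vE phiv mulr0 scale0r oppr0.
- by rewrite gE /f mulVf // scale1r addrC subrK.
- by move=> v vU; rewrite gE /f (phiU _ vU) mulr0 scale0r addr0.
- by move=> v; rewrite gE /f addrC addKr memvZ ?memv_line.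
Qed.

(** * Orbits of the stabiliser of two subspaces on points *)

Lemma dim_limg_GL (F : finFieldType) (V : vectType F) (g : 'End(V))
    (U : {vspace V}) : g \in GL V -> \dim (g @: U)%VS = \dim U.
Proof. by rewrite inE => /eqP g0; rewrite limg_dim_eq // g0 capv0. Qed.

Lemma point_line (F : finFieldType) (V : vectType F) (s : subsp V 1) :
  exists2 u, u != 0 & val s = <[u]>%VS.
Proof.
have /eqP s1 := valP s; exists (vpick (val s)).
  by rewrite vpick0 -dimv_eq0 s1.
apply/eqP; rewrite eq_sym eqEdim -memvE memv_pick /= dim_vline s1.
by rewrite vpick0 -dimv_eq0 s1.
Qed.

Lemma line_point (F : finFieldType) (V : vectType F) (u : V) :
  u != 0 -> exists s : subsp V 1, val s = <[u]>%VS.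
Proof.
move=> u0; have d : \dim <[u]> == 1%N by rewrite dim_vline u0.
by exists (Sub <[u]>%VS d).
Qed.

Definition Stab_invariant (T : Type) (F : finFieldType) (V : vectType F)
    (x y : {vspace V}) (b : subsp V 1 -> T) : Prop :=
  forall g (s t : subsp V 1),
    g \in Stab x y -> (g @: val s)%VS = val t -> b s = b t.

(** The conditions on x and y say that the shear carrying u to u' stabilises
    each of them: it is the identity on U and translates along u' - u. *)
Lemma invariant_shear (T : Type) (F : finFieldType) (V : vectType F)
    (x y : {vspace V}) (b : subsp V 1 -> T) (U : {vspace V}) (u u' : V)
    (s t : subsp V 1) :
    Stab_invariant x y b ->
    val s = <[u]>%VS -> val t = <[u']>%VS -> u \notin U -> u' \notin U ->
    (x <= U)%VS || (u' - u \in x) -> (y <= U)%VS || (u' - u \in y) ->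
  b s = b t.
Proof.
move=> b_inv su tu' uU u'U hx hy.
have [g [g_inj gu gU gB]] := shear_exists uU u'U.
have gGL : g \in GL V by rewrite inE.
have g_stab z : (z <= U)%VS || (u' - u \in z) -> (g @: z)%VS = z.
  move=> hz; apply/eqP; rewrite eqEdim dim_limg_GL // leqnn andbT.
  apply/subvP => _ /memv_imgP[v vz ->].
  case/orP: hz => [/subvP zU|wz]; first by rewrite gU ?zU.
  rewrite -(subrK v (g v)) memvD //; apply: subvP (gB v); by rewrite -memvE.
apply: (b_inv g); first by rewrite inE gGL !g_stab ?eqxx.
by rewrite su tu' limg_line gu.
Qed.

Lemma sub_sum_not_union (K : fieldType) (V : vectType K) (x y : {vspace V}) (u : V) :
  u \in (x + y)%VS -> u \notin x -> u \notin y ->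
  exists a b, [/\ a \in x, b \in y, a \notin y, b \notin x & u = a + b].
Proof.
case/memv_addP=> a ax [b by_ ->] ux uy; exists a, b; split=> //.
  by apply: contra uy => ay; rewrite memvD.
by apply: contra ux => bx; rewrite memvD.
Qed.

(** This is transitivity of Stab x y on each incidence class, phrased through
    invariant functions so that successive moves chain by equality of values,
    without composing the shears. *)
Lemma invariant_classes (T : Type) (F : finFieldType) (V : vectType F)
    (x y : {vspace V}) (b : subsp V 1 -> T) (s t : subsp V 1) :
    Stab_invariant x y b ->
    (val s <= x)%VS = (val t <= x)%VS -> (val s <= y)%VS = (val t <= y)%VS ->
    (val s <= x + y)%VS = (val t <= x + y)%VS ->
  b s = b t.
Proof.
move=> b_inv.
have [u u0 su] := point_line s; have [u' u'0 tu'] := point_line t.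
rewrite su tu' -!memvE => hx hy hxy.
have [ux|ux] := boolP (u \in x); have [uy|uy] := boolP (u \in y);
  move: hx hy hxy; rewrite ?ux ?uy ?(negPf ux) ?(negPf uy) => /esym hx /esym hy.
- move=> _; apply: (invariant_shear b_inv su tu' (U := 0%VS)); rewrite ?memv0 //.
    by rewrite memvB ?orbT // hx.
  by rewrite memvB ?orbT // hy.
- move=> _; apply: (invariant_shear b_inv su tu' (U := y)); rewrite ?hy ?subvv //.
  by rewrite memvB ?orbT // hx.
- move=> _; apply: (invariant_shear b_inv su tu' (U := x)); rewrite ?hx ?subvv //.
  by rewrite memvB ?orbT // hy.
have [uxy|uxy] := boolP (u \in (x + y)%VS) => /esym u'xy; last first.
  apply: (invariant_shear b_inv su tu' (U := (x + y)%VS)); rewrite ?u'xy //.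
    by rewrite addvSl.
  by rewrite addvSr.
(* With u = a + c and u' = a' + c' along x + y, the intermediate vector a' + c
   is reached from u by a shear along x, and leads to u' by one along y. *)
have [a [c [ax cy ay cx uE]]] := sub_sum_not_union uxy ux uy.
have [a' [c' [a'x c'y a'y c'x u'E]]] :=
  sub_sum_not_union u'xy (negbT hx) (negbT hy).
have mx : a' + c \notin x by rewrite rpredDl.
have my : a' + c \notin y by rewrite rpredDr.
have m0 : a' + c != 0 by apply: contraNneq mx => ->; apply: mem0v.
have [m mE] := line_point m0.
transitivity (b m).
  apply: (invariant_shear b_inv su mE uy my); rewrite ?subvv //.
  by rewrite uE opprD addrACA subrr addr0 memvB ?orbT.
apply: (invariant_shear b_inv mE tu' mx (negbT hx)); rewrite ?subvv //.
by rewrite u'E opprD addrACA subrr add0r memvB ?orbT.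
Qed.

(** The coefficients come from inclusion-exclusion on the values of b on the
    five classes. *)
Lemma invariant_combination (R : comNzRingType) (F : finFieldType) (V : vectType F)
    (x y : {vspace V}) (b : subsp V 1 -> R) :
  Stab_invariant x y b ->
  exists c0 c1 c2 c3 c4 : R, forall s : subsp V 1,
    b s = c0 + c1 * (val s <= x)%VS%:R + c2 * (val s <= y)%VS%:R
          + c3 * (val s <= x :&: y)%VS%:R + c4 * (val s <= x + y)%VS%:R.
Proof.
move=> b_inv.
pose cls (s : subsp V 1) :=
  ((val s <= x)%VS, (val s <= y)%VS, (val s <= x + y)%VS).
(* The value of b on the class c; an empty class gets the value 0. *)
pose v c := if [pick s | cls s == c] is Some s then b s else 0.
have bE s : b s = v (cls s).
  rewrite /v; case: pickP => [t /eqP [tx ty txy]|/(_ s)]; last by rewrite eqxx.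
  exact: invariant_classes b_inv _ _ _.
exists (v (false, false, false)), (v (true, false, true) - v (false, false, true)).
exists (v (false, true, true) - v (false, false, true)).
exists (v (true, true, true) - v (true, false, true)
        - (v (false, true, true) - v (false, false, true))).
exists (v (false, false, true) - v (false, false, false)) => s.
rewrite bE /cls subv_cap.
have : ((val s <= x) || (val s <= y) ==> (val s <= x + y))%VS.
  apply/implyP => /orP[] /subv_trans; apply; [exact: addvSl|exact: addvSr].
case: (val s <= x)%VS; case: (val s <= y)%VS; case: (val s <= x + y)%VS => //= _;
  ring.
Qed.

Lemma Stab_fixes (F : finFieldType) (V : vectType F) (x y : {vspace V})
    (g : 'End(V)) : g \in Stab x y ->
  [/\ (g @: x = x)%VS, (g @: y = y)%VS, (g @: (x :&: y) = x :&: y)%VS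
    & (g @: (x + y) = x + y)%VS].
Proof.
rewrite !inE => /and3P[g_inj /eqP gx /eqP gy]; split=> //.
  by rewrite lker0_img_cap // gx gy.
by rewrite limgD gx gy.
Qed.

(** * Independence of indicator functions on points *)

Lemma outside_point (F : finFieldType) (V : vectType F) (x y : {vspace V}) :
  ~~ (x <= y)%VS -> exists s : subsp V 1, (val s <= x)%VS && ~~ (val s <= y)%VS.
Proof.
case/subvPn => u ux uy; have u0 : u != 0.
  by apply: contraNneq uy => ->; apply: mem0v.
by have [s sE] := line_point u0; exists s; rewrite sE -!memvE ux uy.
Qed.

Lemma sum_point (F : finFieldType) (V : vectType F) (x y : {vspace V}) :
  ~~ (x <= y)%VS -> ~~ (y <= x)%VS ->
  exists s : subsp V 1,
    [&& (val s <= x + y)%VS, ~~ (val s <= x)%VS & ~~ (val s <= y)%VS].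
Proof.
case/subvPn => a ax ay /subvPn[b by_ bx].
have abx : a + b \notin x by rewrite rpredDl.
have aby : a + b \notin y by rewrite rpredDr.
have u0 : a + b != 0 by apply: contraNneq abx => ->; apply: mem0v.
by have [s sE] := line_point u0; exists s; rewrite sE -!memvE abx aby memv_add.
Qed.

(** A point outside x + y shows that the constant is 0; then points of x + y
    outside both, of x only, of y only and of x :&: y isolate c4, c1, c2, c3 in
    this order. *)
Lemma indicators_independent (R : fieldType) (F : finFieldType) (V : vectType F)
    (x y : {vspace V}) (c1 c2 c3 c4 : R) :
    ~~ (x <= y)%VS -> ~~ (y <= x)%VS -> ~~ ({:V} <= x + y)%VS ->
    (forall s t : subsp V 1,
      let f (s : subsp V 1) :=
        c1 * (val s <= x)%VS%:R + c2 * (val s <= y)%VS%:R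
        + c3 * (val s <= x :&: y)%VS%:R + c4 * (val s <= x + y)%VS%:R in
      f s = f t) ->
  [/\ c1 = 0, c2 = 0, c4 = 0 & (x :&: y != 0)%VS -> c3 = 0].
Proof.
move=> xy yx xyV f_const.
pose simp := (@mulr0 R, @mulr1 R, @mul0r R, @addr0 R, @add0r R).
have [o /andP[_ oxy]] := outside_point xyV.
have [m /and3P[mxy mx my]] := sum_point xy yx.
have [a /andP[ax ay]] := outside_point xy.
have [b /andP[by_ bx]] := outside_point yx.
have xS (s : subsp V 1) : (val s <= x)%VS -> (val s <= x + y)%VS.
  by move=> /subv_trans; apply; apply: addvSl.
have yS (s : subsp V 1) : (val s <= y)%VS -> (val s <= x + y)%VS.
  by move=> /subv_trans; apply; apply: addvSr.
have f0 (s : subsp V 1) :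
    c1 * (val s <= x)%VS%:R + c2 * (val s <= y)%VS%:R
    + c3 * (val s <= x :&: y)%VS%:R + c4 * (val s <= x + y)%VS%:R = 0.
  rewrite (f_const s o) (negPf (contra (@xS o) oxy)) (negPf (contra (@yS o) oxy)).
  by rewrite (negPf oxy) subv_cap (negPf (contra (@xS o) oxy)) /= !simp.
have c40 : c4 = 0.
  by have := f0 m; rewrite subv_cap mxy (negPf mx) (negPf my) /= !simp.
have c10 : c1 = 0.
  by have := f0 a; rewrite subv_cap c40 ax (negPf ay) /= !simp.
have c20 : c2 = 0.
  by have := f0 b; rewrite subv_cap c40 by_ (negPf bx) /= !simp.
split=> //; rewrite -subv0 => /outside_point[w /andP[wxy _]].
by have := f0 w; rewrite c10 c20 c40 wxy /= !simp.
Qed.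

(** * The regular simplex *)

Section Simplex.
Variables (R : numFieldType) (I : finType) (E : vectType R).
Variables (dot : {dot E for (@idfun R)}) (h : I -> E) (N : R).
Hypothesis N_neq0 : N != 0.
Hypothesis h_norm : forall s, dot (h s) (h s) = N - 1.
Hypothesis h_dot : forall s t, s != t -> dot (h s) (h t) = -1.

Lemma simplex_dot s t : dot (h s) (h t) = N *+ (s == t) - 1.
Proof.
by case: eqVneq => [->|/h_dot->]; rewrite ?h_norm // mulr0n sub0r.
Qed.

Lemma simplex_dot_sum (a : I -> R) t :
  dot (\sum_s a s *: h s) (h t) = N * a t - \sum_s a s.
Proof.
rewrite linear_sumlz; under eq_bigr => s _ do
  rewrite linearZl_LR /= simplex_dot mulrBr mulr1.
rewrite sumrB (bigD1 t) //= eqxx mulr1n mulrC big1 ?addr0 // => s /negPf->.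
by rewrite mulr0.
Qed.

(** Pairing a relation with h t gives N a_t = \sum_s a_s, whose right-hand side
    does not depend on t. *)
Lemma simplex_relation (a : I -> R) :
  \sum_s a s *: h s = 0 -> forall s t, a s = a t.
Proof.
move=> rel s t; have aE r : N * a r = \sum_s a s.
  by apply/eqP; rewrite -subr_eq0 -simplex_dot_sum rel linear0l.
by apply: (mulfI N_neq0); rewrite !aE.
Qed.

Hypothesis h_span : <<codom h>>%VS = {:E}%VS.

Lemma simplex_span v : exists a : I -> R, v = \sum_s a s *: h s.
Proof.
have : v \in <<codom h>>%VS by rewrite h_span memvf.
move/(@coord_span _ _ _ (codom_tuple h)) => ->.
exists (fun s => coord (codom_tuple h) (enum_rank s) v).
rewrite (reindex_onto enum_rank enum_val) => [|i _]; last exact: enum_valK.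
apply: eq_big => [s|s _]; first by rewrite enum_rankK eqxx.
by rewrite (nth_codom 0) enum_rankK.
Qed.

Hypothesis h_sum : \sum_s h s = 0.

(** The operator v |-> \sum_t <v, h t> h t is multiplication by N, since it
    maps each h s to N h s - \sum_t h t. *)
Lemma simplex_expand v : v = N^-1 *: \sum_t dot v (h t) *: h t.
Proof.
apply: (scalerI N_neq0); rewrite scalerA mulfV // scale1r.
have [a ->] := simplex_span v.
under [RHS]eq_bigr => t _ do rewrite simplex_dot_sum scalerBl -scalerA.
by rewrite sumrB -!scaler_sumr h_sum scaler0 subr0.
Qed.
End Simplex.

(** * Hat vectors and the fixed space *)

Lemma hat_point (R : realType) (F : finFieldType) (V : vectType F)
    (E : vectType R) (h : subsp V 1 -> E) (s : subsp V 1) :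
  hat h (val s) = h s.
Proof.
rewrite /hat (eq_bigl (pred1 s)) ?big_pred1_eq // => t; rewrite inE -val_eqE.
by rewrite eqEdim (eqP (valP s)) (eqP (valP t)) leqnn andbT.
Qed.

Lemma hatE (R : realType) (F : finFieldType) (V : vectType F)
    (E : vectType R) (h : subsp V 1 -> E) (u : {vspace V}) :
  hat h u = \sum_s (val s <= u)%VS%:R *: h s.
Proof.
rewrite /hat big_mkcond; apply: eq_bigr => s _.
by case: ifP; rewrite ?scale1r ?scale0r.
Qed.

Lemma hat0 (R : realType) (F : finFieldType) (V : vectType F)
    (E : vectType R) (h : subsp V 1 -> E) : hat h 0%VS = 0.
Proof.
by rewrite /hat big_pred0 // => s; rewrite subv0 -dimv_eq0 (eqP (valP s)).
Qed.

Lemma hat_in_Fix (R : realType) (F : finFieldType) (V : vectType F)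
    (E : vectType R) (h : subsp V 1 -> E) (act : 'End(V) -> 'End(E))
    (x y u : {vspace V}) :
  GL_action h act ->
  (forall g, g \in Stab x y -> (g @: u)%VS = u) ->
  hat h u \in Fix act x y.
Proof.
case=> _ _ actE stab_u; rewrite memvE; apply/subv_bigcapP => g gS.
rewrite -memvE; apply/fixedSpaceP; rewrite actE ?stab_u //.
by move: gS; rewrite inE => /andP[].
Qed.

(** An element g of the stabiliser permutes the point vectors, hence preserves
    inner products, so <v, g s> = <g v, g s> = <v, s> when g fixes v. *)
Lemma Fix_dot_invariant (R : realType) (F : finFieldType) (V : vectType F)
    (E : vectType R) (dot : {dot E for (@idfun R)}) (h : subsp V 1 -> E) (N : R)
    (h_norm : forall s, dot (h s) (h s) = N - 1)
    (h_dot : forall s t, s != t -> dot (h s) (h t) = -1)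
    (h_span : <<codom h>>%VS = {:E}%VS)
    (act : 'End(V) -> 'End(E)) (x y : {vspace V}) (v : E) :
  GL_action h act -> v \in Fix act x y ->
  Stab_invariant x y (fun s => dot v (h s)).
Proof.
move=> [_ _ actE] vFix g s t gS gst.
have gGL : g \in GL V by move: gS; rewrite inE => /andP[].
have vg : act g v = v.
  apply/fixedSpaceP; move: v vFix; apply/subvP.
  by have /subv_bigcapP/(_ g gS) := subvv (Fix act x y).
have [a vE] := simplex_span h_span v.
have im (r : subsp V 1) : {r' : subsp V 1 | val r' = (g @: val r)%VS}.
  have d : \dim (g @: val r) == 1%N by rewrite dim_limg_GL //; exact: (valP r).
  by exists (Sub (g @: val r)%VS d).
rewrite -{2}vg vE linear_sum !linear_sumlz; apply: eq_bigr => r _.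
rewrite linearZ !linearZl_LR /=; congr (_ * _).
have [r' r'E] := im r; rewrite -(hat_point h r) actE // -r'E !hat_point.
rewrite !(simplex_dot h_norm h_dot); congr (_ *+ _ - _).
congr nat_of_bool; rewrite -[RHS]val_eqE -[LHS]val_eqE r'E -gst.
by rewrite eq_limg_ker0 //; move: gGL; rewrite inE.
Qed.

(** * Distance in the Grassmann graph *)

Lemma dim_add_line (K : fieldType) (V : vectType K) (U : {vspace V}) (v : V) :
  v \notin U -> \dim (U + <[v]>) = (\dim U).+1.
Proof.
move=> vU; have v0 : v != 0 by apply: contraNneq vU => ->; apply: mem0v.
rewrite dimv_disjoint_sum ?dim_vline ?v0 ?addn1 //; apply/eqP; rewrite -subv0.
apply/subvP => w /memv_capP[wU /vlineP[c wE]]; rewrite memv0 wE.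
have [->|c0] := eqVneq c 0; first by rewrite scale0r.
by case/negP: vU; rewrite -[v]scale1r -(mulVf c0) -scalerA -wE memvZ.
Qed.

(** H is W plus a complement in x of W + <[a]>, for any a in x outside W. *)
Lemma hyperplane_above (K : fieldType) (V : vectType K) (W x : {vspace V}) :
  (W <= x)%VS -> (\dim W < \dim x)%N ->
  exists H : {vspace V}, [/\ (W <= H)%VS, (H <= x)%VS & (\dim H).+1 = \dim x].
Proof.
move=> Wx lt; have /subvPn[a ax aW] : ~~ (x <= W)%VS.
  by apply: contraL lt => /dimvS; rewrite -leqNgt.
pose A := (W + <[a]>)%VS; exists (W + (x :\: A))%VS.
have Ax : (A <= x)%VS by rewrite subv_add Wx -memvE.
have WD : (W :&: (x :\: A))%VS = 0%VS.
  apply/eqP; rewrite -subv0 -(capv_diff x A) [X in (_ <= X)%VS]capvC.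
  by apply: capvS; [exact: addvSl | exact: subvv].
split; first exact: addvSl.
  by rewrite subv_add Wx diffvSl.
rewrite dimv_disjoint_sum // -addSn -(dim_add_line aW) -/A.
by rewrite -(dimv_cap_compl x A) (capv_idPr Ax).
Qed.

(** z is spanned by a hyperplane of x through x :&: y and a vector of y
    outside x, so it meets y in a larger subspace than x does. *)
Lemma exchange_neighbour (F : finFieldType) (V : vectType F) (k : nat)
    (x y : subsp V k) : (\dim (val x :&: val y) < k)%N ->
  exists2 z : subsp V k, grassmann x z &
    (\dim (val x :&: val y) < \dim (val z :&: val y))%N.
Proof.
have x_k := eqP (valP x); have y_k := eqP (valP y) => lt.
have [|H [WH Hx H_k]] := hyperplane_above (capvSl (val x) (val y)).
  by rewrite x_k.
have /subvPn[b by_ bx] : ~~ (val y <= val x)%VS.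
  apply: contraL lt => yx; rewrite -leqNgt (capv_idPr yx); by rewrite y_k.
have bH : b \notin H by apply: contra bx; apply: subvP.
have z_k : \dim (H + <[b]>) == k by rewrite dim_add_line // H_k x_k.
exists (Sub (H + <[b]>)%VS z_k) => /=.
  have H_sub : (H <= val x :&: (H + <[b]>))%VS by rewrite subv_cap Hx addvSl.
  have Hk1 : k.-1 = \dim H by rewrite -x_k -H_k.
  rewrite /grassmann /= Hk1 eqn_leq (dimvS H_sub) andbT -ltnS H_k x_k.
  rewrite ltnNge; apply: contra bx => le_k.
  have /eqP zE : (val x :&: (H + <[b]>) == H + <[b]>)%VS.
    by rewrite eqEdim capvSr (eqP z_k).
  rewrite memvE; apply: subv_trans (capvSl (val x) (H + <[b]>)%VS).
  by rewrite zE addvSr.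
have /dim_add_line <- : b \notin (val x :&: val y)%VS.
  by apply: contra bx => /memv_capP[].
by rewrite dimvS // subv_cap addvS ?subvv //= subv_add capvSr -memvE.
Qed.

Lemma grassmann_path (F : finFieldType) (V : vectType F) (k : nat)
    (x y : subsp V k) :
  exists p : seq (subsp V k), [/\ path (@grassmann F V k) x p, last x p = y
    & (size p + \dim (val x :&: val y) <= k)%N].
Proof.
have [m] := ubnP (k - \dim (val x :&: val y)); elim: m x => // m IHm x lt_m.
have x_k := eqP (valP x); have y_k := eqP (valP y).
have [lt|ge] := ltnP (\dim (val x :&: val y)) k; last first.
  have xE : (val x :&: val y)%VS = val x.
    by apply/eqP; rewrite eqEdim capvSl x_k.
  exists [::]; split => //=; last by rewrite xE x_k.
  by apply/val_inj/eqP; rewrite eqEdim -{1}xE capvSr x_k y_k leqnn.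
have [z xz lt_z] := exchange_neighbour lt.
have [|p [zp pz le_p]] := IHm z.
  rewrite ltnS in lt_m; apply: leq_trans lt_m; exact: ltn_sub2l.
exists (z :: p); rewrite /= xz; split=> //.
by rewrite addSnnS; apply: leq_trans le_p; rewrite leq_add2l.
Qed.

Lemma gdist_grassmann_le (F : finFieldType) (V : vectType F) (k : nat)
    (x y : subsp V k) :
  (gdist (@grassmann F V k) x y + \dim (val x :&: val y) <= k)%N.
Proof.
have [p [xp <- le_k]] := grassmann_path x y.
by apply: leq_trans le_k; rewrite leq_add2r gdist_le.
Qed.

(** Each step along the path lowers the dimension of the intersection with the
    endpoint by at most one: inside z of dimension k, the subspaces x :&: z and
    z :&: y have codimension 1 and k - dim (z :&: y). *)
Lemma grassmann_path_dim (F : finFieldType) (V : vectType F) (k : nat)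
    (x : subsp V k) (p : seq (subsp V k)) :
  path (@grassmann F V k) x p ->
  (k <= \dim (val x :&: val (last x p)) + size p)%N.
Proof.
elim: p x => [|z p IHp] x /=; first by rewrite capvv (eqP (valP x)) addn0.
case/andP => /eqP xz /IHp le_k; set y := last z p in le_k *.
have := dimv_sum_cap (val x :&: val z)%VS (val z :&: val y)%VS.
have : (\dim (val x :&: val z + val z :&: val y) <= k)%N.
  by rewrite -[leqRHS](eqP (valP z)) dimvS // subv_add capvSr capvSl.
have : (\dim (val x :&: val z :&: (val z :&: val y))
        <= \dim (val x :&: val y))%N.
  by apply/dimvS/capvS; [exact: capvSl|exact: capvSr].
rewrite xz; change (sval x) with (val x); change (sval y) with (val y); lia.
Qed.

(** Stepping towards y one dimension at a time gives the upper bound, and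
    grassmann_path_dim the lower one. *)
Lemma gdist_grassmann (F : finFieldType) (V : vectType F) (k : nat)
    (x y : subsp V k) :
  (gdist (@grassmann F V k) x y + \dim (val x :&: val y))%N = k.
Proof.
apply/eqP; rewrite eqn_leq gdist_grassmann_le /=.
have [q [xq qy _]] := grassmann_path x y.
have xy : connect (@grassmann F V k) x y by apply/connectP; exists q.
have [p [xp py <-]] := gdist_path xy.
by rewrite addnC -py; exact: grassmann_path_dim.
Qed.

(** * The geometric basis *)

Section GeometricBasis.
Variables (R : realType) (F : finFieldType) (V : vectType F) (E : vectType R).
Variables (dot : {dot E for (@idfun R)}) (h : subsp V 1 -> E) (N : R).
Hypothesis N_neq0 : N != 0.
Hypothesis h_norm : forall s, dot (h s) (h s) = N - 1.
Hypothesis h_dot : forall s t, s != t -> dot (h s) (h t) = -1.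

Lemma hat_independent (x y : {vspace V}) (c1 c2 c3 c4 : R) :
    ~~ (x <= y)%VS -> ~~ (y <= x)%VS -> ~~ ({:V} <= x + y)%VS ->
    c1 *: hat h x + c2 *: hat h y + c3 *: hat h (x :&: y)%VS
      + c4 *: hat h (x + y)%VS = 0 ->
  [/\ c1 = 0, c2 = 0, c4 = 0 & (x :&: y != 0)%VS -> c3 = 0].
Proof.
move=> xy yx xyV rel; apply: indicators_independent xy yx xyV _.
apply: (simplex_relation N_neq0 h_norm h_dot); rewrite -[RHS]rel !hatE.
rewrite !scaler_sumr -!big_split /=; apply: eq_bigr => s _.
by rewrite !scalerDl !scalerA.
Qed.

Hypothesis h_span : <<codom h>>%VS = {:E}%VS.
Hypothesis h_sum : \sum_s h s = 0.

Lemma Fix_combination (act : 'End(V) -> 'End(E)) (x y : {vspace V}) (v : E) :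
  GL_action h act -> v \in Fix act x y ->
  exists c1 c2 c3 c4 : R,
    v = c1 *: hat h x + c2 *: hat h y + c3 *: hat h (x :&: y)%VS
        + c4 *: hat h (x + y)%VS.
Proof.
move=> act_GL vFix.
have := Fix_dot_invariant h_norm h_dot h_span act_GL vFix.
case/invariant_combination => c0 [c1 [c2 [c3 [c4 cE]]]].
exists (N^-1 * c1), (N^-1 * c2), (N^-1 * c3), (N^-1 * c4).
rewrite [LHS](simplex_expand N_neq0 h_norm h_dot h_span h_sum) !hatE.
rewrite -!scalerA -!scalerDr; congr (_ *: _); rewrite !scaler_sumr -!big_split /=.
(* The constant part of the coordinate function contributes nothing. *)
have c0h : \sum_s c0 *: h s = 0 by rewrite -scaler_sumr h_sum scaler0.
rewrite -[RHS]add0r -[X in X + _]c0h -big_split /=.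
by apply: eq_bigr => s _; rewrite cE !scalerDl !scalerA !addrA.
Qed.

Lemma hat_Fix (act : 'End(V) -> 'End(E)) (x y : {vspace V}) :
  GL_action h act ->
  [/\ hat h x \in Fix act x y, hat h y \in Fix act x y,
      hat h (x :&: y)%VS \in Fix act x y & hat h (x + y)%VS \in Fix act x y].
Proof.
by move=> act_GL; split; apply: hat_in_Fix act_GL _ => g /Stab_fixes[].
Qed.

Lemma geometric_basis_meeting (act : 'End(V) -> 'End(E)) (x y : {vspace V}) :
    GL_action h act ->
    ~~ (x <= y)%VS -> ~~ (y <= x)%VS -> ~~ ({:V} <= x + y)%VS ->
    (x :&: y != 0)%VS ->
  basis_of (Fix act x y)
    [:: hat h x; hat h y; hat h (x :&: y)%VS; hat h (x + y)%VS].
Proof.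
move=> act_GL xy yx xyV xy0; have [Fx Fy Fi Fs] := hat_Fix x y act_GL.
set X := [:: _; _; _; _]; apply/andP; split.
  rewrite eqEsubv; apply/andP; split.
    by apply/span_subvP => v; rewrite !inE => /or4P[] /eqP->.
  apply/subvP => v /(Fix_combination act_GL)[c1 [c2 [c3 [c4 ->]]]].
  by rewrite !memvD // memvZ // memv_span // !inE eqxx ?orbT.
apply/(@freeP _ _ 4 [tuple of X]) => c.
rewrite !big_ord_recl big_ord0 /= addr0 !addrA.
case/(hat_independent xy yx xyV) => c1 c2 c4 /(_ xy0) c3 i.
by case: i => [[|[|[|[|//]]]] i_lt]; [move: c1|move: c2|move: c3|move: c4] => <-;
  congr c; apply: val_inj.
Qed.

(** The relation is padded with a zero coefficient on the hat of x :&: y = 0,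
    so that independence of the four hats applies. *)
Lemma geometric_basis_disjoint (act : 'End(V) -> 'End(E)) (x y : {vspace V}) :
    GL_action h act ->
    ~~ (x <= y)%VS -> ~~ (y <= x)%VS -> ~~ ({:V} <= x + y)%VS ->
    (x :&: y = 0)%VS ->
  basis_of (Fix act x y) [:: hat h x; hat h y; hat h (x + y)%VS].
Proof.
move=> act_GL xy yx xyV xy0; have [Fx Fy Fi Fs] := hat_Fix x y act_GL.
set X := [:: _; _; _]; apply/andP; split.
  rewrite eqEsubv; apply/andP; split.
    by apply/span_subvP => v; rewrite !inE => /or3P[] /eqP->.
  apply/subvP => v /(Fix_combination act_GL)[c1 [c2 [c3 [c4 ->]]]].
  by rewrite xy0 hat0 scaler0 addr0 !memvD // memvZ // memv_span // !inE eqxx ?orbT.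
apply/(@freeP _ _ 3 [tuple of X]) => c.
rewrite !big_ord_recl big_ord0 /= addr0 !addrA => rel.
have := @hat_independent x y (c ord0) (c (lift ord0 ord0)) 0 _ xy yx xyV.
rewrite scale0r addr0 => /(_ _ rel)[c1 c2 c4 _] i.
by case: i => [[|[|[|//]]] i_lt]; [move: c1|move: c2|move: c4] => <-;
  congr c; apply: val_inj.
Qed.

End GeometricBasis.

Theorem theorem8p3 (R : realType) (F : finFieldType) (V : vectType F)
  (n k : nat) (dimV : \dim {:V} = n) (hnk : (2 * k < n)%N) (hk : (6 <= 2 * k)%N)
  (E : vectType R) (dot : {dot E for (@idfun R)})
  (dimE : (\dim {:E})%:R = qbracket R #|F| n - 1)
  (h : subsp V 1 -> E)
  (h_span : <<codom h>>%VS = {:E}%VS)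
  (h_norm : forall s, dot (h s) (h s) = qbracket R #|F| n - 1)
  (h_dot : forall s t, s != t -> dot (h s) (h t) = -1)
  (h_sum : \sum_(s : subsp V 1) h s = 0)
  (act : 'End(V) -> 'End(E)) (act_GL : GL_action h act)
  (x y : subsp V k) (x_neq_y : x != y) :
  ((1 <= gdist (@grassmann F V k) x y < k)%N ->
     basis_of (Fix act (val x) (val y))
       [:: hat h (val x); hat h (val y);
           hat h (val x :&: val y)%VS; hat h (val x + val y)%VS])
  /\
  (gdist (@grassmann F V k) x y = k ->
     basis_of (Fix act (val x) (val y))
       [:: hat h (val x); hat h (val y); hat h (val x + val y)%VS]).
Proof.
have N_neq0 : qbracket R #|F| n != 0.
  have q_gt1 : 1 < #|F|%:R :> R by rewrite ltr1n card_finNzRing_gt1.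
  rewrite /qbracket mulf_neq0 ?invr_eq0 // gt_eqF ?subr_gt0 //.
  by rewrite -exprnP exprn_egt1 // -lt0n (leq_ltn_trans _ hnk).
have x_k := eqP (valP x); have y_k := eqP (valP y).
have xy : ~~ (val x <= val y)%VS.
  by apply: contra x_neq_y => xy; rewrite -val_eqE eqEdim xy x_k y_k leqnn.
have yx : ~~ (val y <= val x)%VS.
  by apply: contra x_neq_y => yx; rewrite eq_sym -val_eqE eqEdim yx x_k y_k leqnn.
have xyV : ~~ ({:V} <= val x + val y)%VS.
  apply: contraL hnk => /dimvS; rewrite dimV -leqNgt => /leq_trans; apply.
  by have := (dimv_add_leqif (val x) (val y)).1; rewrite x_k y_k addnn mul2n.
have dist := gdist_grassmann x y.
split=> [/andP[_ lt_k] | eq_k].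
  apply: (geometric_basis_meeting N_neq0 h_norm h_dot) => //.
  rewrite -dimv_eq0; lia.
apply: (geometric_basis_disjoint N_neq0 h_norm h_dot) => //.
apply/eqP; rewrite -dimv_eq0; lia.
Qed.
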